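(* ($d$-step backward formula.) Let $x$ be the state of the delayed Markov jump linear system in the context, and let $d\le k\le N+1$. For any $\mathcal{G}_k$-measurable function $f_{\theta(k)}$ (a matrix-valued function $l\mapsto f_l$ of the mode, evaluated at $\theta(k)$, of dimensions compatible with $x(k)$), $$\mathrm{E}\{f_{\theta(k)}x(k)\mid\mathcal{G}_{k-d}\}=\Lambda_{l_{k-d},l_k}[f_{l_k}F_{l_{k-1},l_{k-d}}]\,x(k-d)+\sum_{i=k-d}^{k-1}\Lambda_{l_{k-d},l_k}[f_{l_k}F_{l_{k-1},l_{i+1}}B_{l_i}]\,u(i-d),$$ where on the right-hand side $l_{k-d}=\theta(k-d)$.
   Context: Let $d>0$ and $N>d$ be integers. $\theta(k)$, $k\ge0$, is a discrete-time Markov chain with finite state space $\Theta=\{1,\dots,L\}$ and transition probabilities $\lambda_{l_k,l_{k+1}}=\mathrm{P}(\theta(k+1)=l_{k+1}\mid\theta(k)=l_k)$. Let $\mathcal{G}_k$ be the $\sigma$-algebra generated by $\theta(0),\dots,\theta(k)$. The system is $$x(k+1)=A_{\theta(k)}(k)x(k)+B_{\theta(k)}(k)u(k-d),\qquad k=0,\dots,N,$$ with $x(k)\in\mathbb{R}^n$, $u(k)\in\mathbb{R}^m$, deterministic matrices $A_l(k),B_l(k)$ ($l\in\Theta$), known initial values $x(0)=x_0$ and $u(-d),\dots,u(-1)$ (independent of $\theta$), and controls $u(k)$ that are $\mathcal{G}_k$-measurable for $k\ge0$. Notation: $l_t\in\Theta$ is the mode at time $t$ and explicit time arguments are suppressed,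 $A_{l_t}=A_{l_t}(t)$, $B_{l_t}=B_{l_t}(t)$; $F_{l_t,l_i}=A_{l_t}A_{l_{t-1}}\cdots A_{l_i}$ for $i\le t$ and $F_{l_t,l_{t+1}}=I$. $\Lambda_{l_{k-d},l_k}$ denotes the iterated sum $\sum_{l_{k-d+1}=1}^L\lambda_{l_{k-d},l_{k-d+1}}\cdots\sum_{l_k=1}^L\lambda_{l_{k-1},l_k}$ applied to the bracketed expression following it. *)

(* Defs.v *)
From HB Require Import structures.
From mathcomp Require Import all_boot all_order all_algebra.
From mathcomp Require Import all_classical all_reals all_analysis.

Set Implicit Arguments.
Unset Strict Implicit.
Unset Printing Implicit Defensive.

Import Order.TTheory GRing.Theory Num.Theory.
Import numFieldNormedType.Exports.

Local Open Scope classical_set_scope.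
Local Open Scope ring_scope.

(* Modes are 'I_L = {0, ..., L-1} instead of {1, ..., L}. *)

(* [Y] is measurable with respect to the sigma-algebra [G], given as a family
   of subsets of [T]: the sigma-algebra generated by [Y] is contained in [G]. *)
Definition adapted_to (T : Type) (R : realType) (G : set (set T)) (Y : T -> R)
  : Prop :=
  preimage_set_system setT Y measurable `<=` G.

Definition mx_adapted_to (T : Type) (R : realType) (p q : nat)
    (G : set (set T)) (Y : T -> 'M[R]_(p, q)) : Prop :=
  forall i j, adapted_to G (fun w => Y w i j).

(* [Y] is a version of E{X | G}; as usual, an equality E{X | G} = Y is an
   equality up to a P-null set, that is, it says that [Y] is such a version. *)
Definition is_cond_expectation (disp : measure_display)
    (T : measurableType disp) (R : realType) (P : probability T R)
    (G : set (set T)) (X Y : T -> R) : Prop :=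
  [/\ P.-integrable setT (EFin \o X),
      P.-integrable setT (EFin \o Y),
      adapted_to G Y
    & forall E : set T, G E ->
        (\int[P]_(w in E) (Y w)%:E = \int[P]_(w in E) (X w)%:E)%E].

Definition is_mx_cond_expectation (disp : measure_display)
    (T : measurableType disp) (R : realType) (P : probability T R) (p q : nat)
    (G : set (set T)) (X Y : T -> 'M[R]_(p, q)) : Prop :=
  forall i j, is_cond_expectation P G (fun w => X w i j) (fun w => Y w i j).

(* P(E | H); only meaningful when P(H) > 0. *)
Definition cond_prob (disp : measure_display) (T : measurableType disp)
    (R : realType) (P : probability T R) (E H : set T) : R :=
  fine (P (E `&` H)) / fine (P H).

Definition stochastic_matrix (R : realType) (L : nat)
    (lambda : 'I_L -> 'I_L -> R) : Prop :=
  (forall l l', 0 <= lambda l l') /\ (forall l, \sum_(l' < L) lambda l l' = 1).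

(* [h] lists the modes visited; only [h 0], ..., [h k] are used at time [k].
   The initial distribution is arbitrary. *)
Definition markov_chain (disp : measure_display) (T : measurableType disp)
    (R : realType) (P : probability T R) (L : nat)
    (lambda : 'I_L -> 'I_L -> R) (theta : nat -> T -> 'I_L) : Prop :=
  [/\ forall (k : nat) (l : 'I_L), measurable [set w | theta k w = l],
      stochastic_matrix lambda,
      forall (k : nat) (h : nat -> 'I_L) (l' : 'I_L),
        let H := [set w | forall j : nat, (j <= k)%N -> theta j w = h j] in
        (0 < P H)%E ->
        cond_prob P [set w | theta k.+1 w = l'] H =
        cond_prob P [set w | theta k.+1 w = l'] [set w | theta k w = h k]
    & forall (k : nat) (l l' : 'I_L),
        (0 < P [set w | theta k w = l])%E ->
        lambda l l' =
        cond_prob P [set w | theta k.+1 w = l'] [set w | theta k w = l]].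

(* The sigma-algebra generated by theta(0), ..., theta(k), where the finite
   set of modes carries the sigma-algebra of all its subsets. *)
Definition mode_sigma (T : Type) (L : nat) (theta : nat -> T -> 'I_L)
    (k : nat) : set (set T) :=
  <<s [set E | exists (j : nat) (S : set 'I_L),
                 (j <= k)%N /\ E = theta j @^-1` S] >>.

(* The control is indexed by [int], since u(-d), ..., u(-1) are initial data. *)
Definition delayed_mjls (T : Type) (R : realType) (L n m d N : nat)
    (A : 'I_L -> nat -> 'M[R]_n) (B : 'I_L -> nat -> 'M[R]_(n, m))
    (theta : nat -> T -> 'I_L) (x0 : 'cV[R]_n) (uinit : int -> 'cV[R]_m)
    (x : nat -> T -> 'cV[R]_n) (u : int -> T -> 'cV[R]_m) : Prop :=
  [/\ forall w, x 0%N w = x0,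
      forall (t : int) (w : T), - d%:Z <= t < 0 -> u t w = uinit t,
      forall k : nat, mx_adapted_to (mode_sigma theta k) (u k%:Z)
    & forall (k : nat) (w : T), (k <= N)%N ->
        x k.+1 w = A (theta k w) k *m x k w
                   + B (theta k w) k *m u (k%:Z - d%:Z) w].

(* Bracketed expressions in the modes are functions of [l : nat -> 'I_L], with
   [l t] standing for the mode l_t at time [t]. *)

(* F_{l_t,l_i} = A_{l_t}(t) A_{l_{t-1}}(t-1) ... A_{l_i}(i); the range is empty,
   and the value is the identity, when i = t + 1. *)
Definition Fprod (R : realType) (L n : nat) (A : 'I_L -> nat -> 'M[R]_n)
    (l : nat -> 'I_L) (t i : nat) : 'M[R]_n :=
  \big[mulmx/1%:M]_(j <- rev (index_iota i t.+1)) A (l j) j.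

Definition set_mode (L : nat) (l : nat -> 'I_L) (t : nat) (c : 'I_L)
  : nat -> 'I_L :=
  fun j => if j == t then c else l j.

(* Lambda_{l_s,l_{s+r}}[E]: the iterated sum over the modes l_{s+1}, ...,
   l_{s+r}.  The mode l_s is read off [l]; the values of [l] at the times
   s + 1, ..., s + r are overwritten by the summation variables. *)
Fixpoint Lambda (R : realType) (L : nat) (lambda : 'I_L -> 'I_L -> R)
    (V : lmodType R) (s r : nat) (E : (nat -> 'I_L) -> V) (l : nat -> 'I_L)
    {struct r} : V :=
  match r with
  | 0%N => E l
  | r'.+1 => \sum_(c < L)
      lambda (l s) c *: Lambda lambda s.+1 r' E (set_mode l s.+1 c)
  end.

(* Main.v *)
(* Each G_s is generated by the finite partition of the sample space according
   to the modes at times 0, ..., s, so G_s-measurability means being a function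
   of these modes and every integral is a finite sum.  On an atom of G_s the
   Markov property replaces the mode at time s + 1 by an average with weights
   lambda; iterating this d times gives the operator Lambda.  Unrolling the
   recursion writes f x(k) in terms of x(k-d) and the controls u(i-d), i < k,
   all of which are functions of the modes up to time k-d and hence factor out
   of Lambda. *)

Require Import Defs.
From HB Require Import structures.
From mathcomp Require Import all_boot all_order all_algebra.
From mathcomp Require Import all_classical all_reals all_analysis.

Import Order.TTheory GRing.Theory Num.Theory.
Import numFieldNormedType.Exports.

Local Open Scope classical_set_scope.
Local Open Scope ring_scope.

Set Implicit Arguments.
Unset Strict Implicit.

(** * Functions of a finite-valued random variable: measurability and integrals *)

Lemma measurable_finite_preimage (disp : measure_display)
    (T : measurableType disp) (I : finType) (X : T -> I) (A : set I) :
  (forall i, measurable [set w | X w = i]) -> measurable (X @^-1` A).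
Proof.
move=> mX; rewrite (_ : _ @^-1` _ = \bigcup_(i in A) [set w | X w = i]).
  by apply: fin_bigcup_measurable => //; exact: finite_finset.
by apply/seteqP; split=> [w Aw|w [i Ai /= e]]; [exists (X w)|rewrite /preimage /= e].
Qed.

Lemma finite_comp_sum (T : Type) (R : realType) (I : finType) (X : T -> I)
    (phi : I -> R) (w : T) :
  (phi (X w))%:E =
  (\sum_(i : I) (phi i)%:E * (\1_[set w' | X w' = i] w)%:E)%E.
Proof.
rewrite (bigD1 (X w)) //= big1 ?adde0.
  by rewrite indicE mem_set //= mule1.
by move=> i /eqP iX; rewrite indicE memNset ?mule0 // => /esym.
Qed.

Lemma integrable_finite_comp (disp : measure_display)
    (T : measurableType disp) (R : realType) (P : probability T R)
    (I : finType) (X : T -> I) (phi : I -> R) :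
  (forall i, measurable [set w | X w = i]) ->
  P.-integrable setT (EFin \o (phi \o X)).
Proof.
move=> mX; rewrite (_ : EFin \o _ = fun w =>
    (\sum_(i : I) (phi i)%:E * (\1_[set w' | X w' = i] w)%:E)%E); last first.
  by apply/funext => w /=; exact: finite_comp_sum.
apply: integrable_sum => // i _.
by apply: integrableZl => //; exact: integrable_indic.
Qed.

Lemma integral_finite_comp (disp : measure_display)
    (T : measurableType disp) (R : realType) (P : probability T R)
    (I : finType) (X : T -> I) (phi : I -> R) :
  (forall i, measurable [set w | X w = i]) ->
  (\int[P]_w (phi (X w))%:E =
   (\sum_(i : I) phi i * fine (P [set w | X w = i]))%:E)%E.
Proof.
move=> mX.
under eq_integral do rewrite (finite_comp_sum X phi).
rewrite integral_sum //; last first.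
  by move=> i; apply: integrableZl => //; exact: integrable_indic.
rewrite -sumEFin; apply: eq_bigr => i _.
rewrite integralZl //; last exact: integrable_indic.
by rewrite integral_indic // setIT EFinM fineK // fin_num_measure.
Qed.

(** * The filtration of the modes, described through paths *)

Definition mode_path (T : Type) (L : nat) (theta : nat -> T -> 'I_L)
  (s : nat) (w : T) : {ffun 'I_s.+1 -> 'I_L} := [ffun j : 'I_s.+1 => theta j w].

(* Stands in for [mode_sigma theta s]-measurability; since [V] is arbitrary, it
   also covers events ([V := Prop]) and random functions. *)
Definition causal (T : Type) (L : nat) (theta : nat -> T -> 'I_L) (V : Type)
    (s : nat) (Y : T -> V) : Prop :=
  forall w w', mode_path theta s w = mode_path theta s w' -> Y w = Y w'.

Lemma mode_path_eqP (T : Type) (L : nat) (theta : nat -> T -> 'I_L) (s : nat)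
    (w w' : T) :
  mode_path theta s w = mode_path theta s w' <->
  (forall j, (j <= s)%N -> theta j w = theta j w').
Proof.
split=> [/ffunP e j js|e]; last first.
  by apply/ffunP => j; rewrite !ffunE e // -ltnS.
by have := e (Ordinal (js : (j < s.+1)%N)); rewrite !ffunE.
Qed.

Lemma causalW (T : Type) (L : nat) (theta : nat -> T -> 'I_L) (V : Type)
    (s s' : nat) (Y : T -> V) :
  (s <= s')%N -> causal theta s Y -> causal theta s' Y.
Proof.
move=> ss' cY w w' e; apply: cY; apply/mode_path_eqP => j js.
by apply: (mode_path_eqP _ _ _ _).1 e _ _; exact: leq_trans ss'.
Qed.

Lemma causal_mode (T : Type) (L : nat) (theta : nat -> T -> 'I_L)
    (s j : nat) : (j <= s)%N -> causal theta s (theta j).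
Proof. by move=> js w w' /mode_path_eqP /(_ _ js). Qed.

Lemma causal_factor (T : Type) (L : nat) (theta : nat -> T -> 'I_L)
    (V : Type) (v0 : V) (s : nat) (Y : T -> V) :
  causal theta s Y -> exists phi, Y = phi \o mode_path theta s.
Proof.
move=> cY.
(* The value at a realised path is read at a chosen sample point; [v0] fills in the paths that no
   sample point realises. *)
exists (fun h => if pselect (exists w, mode_path theta s w = h) is left e
                 then Y (projT1 (cid e)) else v0).
apply/funext => w /=; case: pselect => [e|[]]; last by exists w.
by case: cid => w' /= /cY.
Qed.

(** The causal events form a sigma-algebra containing the generators, hence contain the smallest
    one. *)
Lemma mode_sigma_causal (T : Type) (L : nat) (theta : nat -> T -> 'I_L)
    (s : nat) (E : set T) : mode_sigma theta s E -> causal theta s E.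
Proof.
apply: (smallest_sub (X := [set E : set T | causal theta s E])); last first.
  by move=> _ [j [S [js ->]]] w w' e; rewrite /preimage /= (causal_mode js e).
split=> //= [A cA w w' /cA e|F cF w w' e].
  by rewrite /setD /= e.
by rewrite /bigcup /=; apply/propext; split=> -[i _ Fi]; exists i => //;
  move: Fi; rewrite (cF i _ _ e).
Qed.

Lemma mode_sigma_atom (T : pointedType) (L : nat) (theta : nat -> T -> 'I_L)
    (s : nat) (h : {ffun 'I_s.+1 -> 'I_L}) :
  mode_sigma theta s [set w | mode_path theta s w = h].
Proof.
rewrite (_ : [set w | _] =
    \bigcap_(j in [set: 'I_s.+1]) (theta j @^-1` [set h j])).
  have mS j : (@measurable _ (g_sigma_algebraType
      [set E | exists (j : nat) (S : set 'I_L),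
                 (j <= s)%N /\ E = theta j @^-1` S]))
      (theta (j : 'I_s.+1) @^-1` [set h j]).
    by apply: sub_sigma_algebra; exists j, [set h j]; rewrite -ltnS.
  by apply: (fin_bigcap_measurable _ (fun j _ => mS j)) => //; exact: finite_finset.
apply/seteqP; split=> [w <- j _ /=|w e]; first by rewrite ffunE.
by apply/ffunP => j; rewrite ffunE; exact: e.
Qed.

(** Since [Y] factors through the path, its preimages are finite unions of the atoms of
    [mode_sigma theta s]. *)
Lemma causal_adapted (T : pointedType) (R : realType) (L : nat)
    (theta : nat -> T -> 'I_L) (s : nat) (Y : T -> R) :
  causal theta s Y -> adapted_to (mode_sigma theta s) Y.
Proof.
move=> cY; have [phi ->] := causal_factor 0 cY.
move=> _ [B _ <-]; rewrite setTI.
rewrite -[_ @^-1` B]/(mode_path theta s @^-1` (phi @^-1` B)).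
(* [U] is [T] with [mode_sigma theta s] as its sigma-algebra, so that measurability in [U] means
   membership there. *)
pose U : measurableType _ := g_sigma_algebraType
  [set E | exists (j : nat) (S : set 'I_L),
             (j <= s)%N /\ E = theta j @^-1` S].
exact: (@measurable_finite_preimage _ U _ (mode_path theta s : U -> _) _
  (mode_sigma_atom (theta := theta) (s := s))).
Qed.

(** Singletons are Borel, so each level set of [Y] is an event of [mode_sigma theta s] and cannot
    separate two points with the same path. *)
Lemma adapted_causal (T : Type) (R : realType) (L : nat)
    (theta : nat -> T -> 'I_L) (s : nat) (Y : T -> R) :
  adapted_to (mode_sigma theta s) Y -> causal theta s Y.
Proof.
move=> aY w w' e.
have /mode_sigma_causal /(_ _ _ e) : mode_sigma theta s (Y @^-1` [set Y w']).
  by apply: aY; exists [set Y w'] => //; rewrite setTI.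
by rewrite /preimage /= => ->.
Qed.

Lemma mx_adapted_causal (T : Type) (R : realType) (L p q : nat)
    (theta : nat -> T -> 'I_L) (s : nat) (Y : T -> 'M[R]_(p, q)) :
  mx_adapted_to (mode_sigma theta s) Y -> causal theta s Y.
Proof.
by move=> aY w w' e; apply/matrixP => i j; exact: (adapted_causal (aY i j)).
Qed.

Lemma measurable_mode_path (disp : measure_display)
    (T : measurableType disp) (L : nat) (theta : nat -> T -> 'I_L) (s : nat)
    (h : {ffun 'I_s.+1 -> 'I_L}) :
  (forall j l, measurable [set w | theta j w = l]) ->
  measurable [set w | mode_path theta s w = h].
Proof.
move=> mt; rewrite (_ : [set w | _] =
    \bigcap_(j in [set: 'I_s.+1]) [set w | theta j w = h j]).
  by apply: fin_bigcap_measurable => //; exact: finite_finset.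
apply/seteqP; split=> [w <- j _ /=|w e]; first by rewrite ffunE.
by apply/ffunP => j; rewrite ffunE; exact: e.
Qed.

Lemma causal_integrable (disp : measure_display) (T : measurableType disp)
    (R : realType) (P : probability T R) (L : nat)
    (theta : nat -> T -> 'I_L) (s : nat) (Y : T -> R) :
  (forall j l, measurable [set w | theta j w = l]) ->
  causal theta s Y -> P.-integrable setT (EFin \o Y).
Proof.
move=> mt cY; have [phi ->] := causal_factor 0 cY.
by apply: integrable_finite_comp => h; exact: measurable_mode_path.
Qed.

(** * The Markov property integrated over one time step *)

Lemma markov_step_prob (disp : measure_display) (T : measurableType disp)
    (R : realType) (P : probability T R) (L : nat)
    (lambda : 'I_L -> 'I_L -> R) (theta : nat -> T -> 'I_L) (s : nat)
    (h : {ffun 'I_s.+1 -> 'I_L}) (c : 'I_L) :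
  markov_chain P lambda theta ->
  fine (P [set w | (mode_path theta s w, theta s.+1 w) = (h, c)]) =
  lambda (h ord_max) c * fine (P [set w | mode_path theta s w = h]).
Proof.
case=> mt _ markov trans.
have mH := measurable_mode_path h mt.
have -> : [set w | (mode_path theta s w, theta s.+1 w) = (h, c)] =
    [set w | theta s.+1 w = c] `&` [set w | mode_path theta s w = h].
  by apply/seteqP; split=> w /= [e1 e2]; rewrite /= e1 e2.
(* On a null atom conditional probabilities say nothing, but both sides vanish. *)
have [P0|] := eqVneq (P [set w | mode_path theta s w = h]) 0%E.
  rewrite P0 mulr0 (@subset_measure0 _ _ _ P _ _ _ mH) //.
  exact: measurableI.
rewrite -measure_gt0 => Ppos.
(* The history in [markov_chain] is indexed by [nat]; [g] extends [h] past time [s] by irrelevant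
   values. *)
pose g j := h (inord j).
have HE : [set w | forall j : nat, (j <= s)%N -> theta j w = g j] =
    [set w | mode_path theta s w = h].
  apply/seteqP; split=> w /= e.
    by apply/ffunP => j; rewrite ffunE e ?leq_ord // /g inord_val.
  by move=> j js; rewrite /g -e ffunE inordK.
have gE : g s = h ord_max by congr (h _); apply/val_inj; rewrite /= inordK.
have := markov s g c; rewrite /= HE => /(_ Ppos).
(* The event for the mode at time [s] contains the atom, so it too has positive probability. *)
rewrite -trans; last first.
  apply: lt_le_trans Ppos _; apply: le_measure; rewrite ?inE //.
  by move=> w e /=; rewrite gE -e ffunE.
rewrite /cond_prob gE => <-; rewrite divfK //.
by rewrite gt_eqF // fine_gt0 // Ppos ltey_eq fin_num_measure.
Qed.

(** Both integrals are finite sums, over pairs (path up to [s], next mode) and over paths;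
    [markov_step_prob] matches them term by term. *)
Lemma markov_one_step (disp : measure_display) (T : measurableType disp)
    (R : realType) (P : probability T R) (L : nat)
    (lambda : 'I_L -> 'I_L -> R) (theta : nat -> T -> 'I_L) (s : nat)
    (Y : T -> 'I_L -> R) (E : set T) :
  markov_chain P lambda theta ->
  causal theta s E -> causal theta s Y ->
  (\int[P]_(w in E) (Y w (theta s.+1 w))%:E =
   \int[P]_(w in E) (\sum_(c < L) lambda (theta s w) c * Y w c)%:E)%E.
Proof.
move=> mc cE cY; have [mt _ _ _] := mc.
(* Absorbing the indicator of [E] into [Y] leaves integrals over the whole space of a function of
   the path. *)
have cEY : causal theta s (fun w => fun c => (w \in E)%:R * Y w c).
  move=> w w' e; apply/funext => c; rewrite (cY _ _ e).
  suff -> : (w \in E) = (w' \in E) by [].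
  by apply/idP/idP; rewrite !inE (cE _ _ e).
have [phi ephi] := causal_factor (fun=> 0) cEY.
have phiE w c : (w \in E)%:R * Y w c = phi (mode_path theta s w) c.
  by move/(congr1 (fun Z => Z w c)): ephi.
have mE (Z : T -> R) :
    (\int[P]_(w in E) (Z w)%:E = \int[P]_w ((w \in E)%:R * Z w)%:E)%E.
  rewrite integral_mkcond; apply: eq_integral => w _; rewrite patchE.
  by case: ifP => _; rewrite ?mul1r ?mul0r.
rewrite !mE.
pose X w := (mode_path theta s w, theta s.+1 w).
have mX hc : measurable [set w | X w = hc].
  case: hc => h c; rewrite (_ : [set w | _] =
    [set w | mode_path theta s w = h] `&` [set w | theta s.+1 w = c]).
    by apply: measurableI => //; exact: measurable_mode_path.
  by apply/seteqP; split=> w /= [e1 e2]; rewrite /X e1 e2.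
pose psi (h : {ffun 'I_s.+1 -> 'I_L}) := \sum_(c < L) lambda (h ord_max) c * phi h c.
have psiE w : (w \in E)%:R * \sum_(c < L) lambda (theta s w) c * Y w c =
    psi (mode_path theta s w).
  rewrite mulr_sumr; apply: eq_bigr => c _.
  by rewrite mulrCA phiE ffunE.
under eq_integral do rewrite phiE.
under [RHS]eq_integral do rewrite psiE.
rewrite (integral_finite_comp P (fun hc => phi hc.1 hc.2) mX).
rewrite integral_finite_comp; last by move=> h; exact: measurable_mode_path.
congr EFin; under [RHS]eq_bigr do rewrite mulr_suml.
rewrite pair_bigA; apply: eq_bigr => -[h c] _ /=.
by rewrite (markov_step_prob h c mc) mulrCA mulrA.
Qed.

(** * Locality and linearity of the operator [Lambda] *)

Definition agree (L : nat) (s t : nat) (l l' : nat -> 'I_L) : Prop :=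
  forall j, (s <= j <= t)%N -> l j = l' j.

(** Mode sequences are total functions on [nat]; locality permits changing them outside the times
    that an expression reads. *)
Definition local_on (L : nat) (V : Type) (s t : nat)
    (E : (nat -> 'I_L) -> V) : Prop :=
  forall l l', agree s t l l' -> E l = E l'.

(** Each sum overwrites the mode that follows, so dependence on the times after [s] disappears one
    time per summation. *)
Lemma Lambda_local (R : realType) (L : nat) (lambda : 'I_L -> 'I_L -> R)
    (V : lmodType R) (s0 s r : nat) (E : (nat -> 'I_L) -> V) :
  (s0 <= s)%N -> local_on s0 (s + r) E ->
  local_on s0 s (Lambda lambda s r E).
Proof.
elim: r s => [|r IH] s ss; first by rewrite addn0.
move=> lE l l' e /=; apply: eq_bigr => c _.
have -> : l s = l' s by apply: e; rewrite ss leqnn.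
congr (_ *: _).
apply: (IH s.+1) => //; [exact: leqW|by rewrite addSnnS|].
move=> j /andP[sj js]; rewrite /set_mode; case: eqP => // /eqP js1.
by apply: e; rewrite sj -ltnS ltn_neqAle js1.
Qed.

Lemma Lambda_sum (R : realType) (L : nat) (lambda : 'I_L -> 'I_L -> R)
    (V : lmodType R) (s r : nat) (I : Type) (q : seq I)
    (E : I -> (nat -> 'I_L) -> V) (l : nat -> 'I_L) :
  Lambda lambda s r (fun l => \sum_(i <- q) E i l) l =
  \sum_(i <- q) Lambda lambda s r (E i) l.
Proof.
elim: r s l => [|r IH] s l //=.
rewrite exchange_big /=; apply: eq_bigr => c _.
by rewrite IH scaler_sumr.
Qed.

Lemma Lambda_add (R : realType) (L : nat) (lambda : 'I_L -> 'I_L -> R)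
    (V : lmodType R) (s r : nat) (E E' : (nat -> 'I_L) -> V)
    (l : nat -> 'I_L) :
  Lambda lambda s r (fun l => E l + E' l) l =
  Lambda lambda s r E l + Lambda lambda s r E' l.
Proof.
elim: r s l => [|r IH] s l //=.
by rewrite -big_split; apply: eq_bigr => c _; rewrite IH scalerDr.
Qed.

Lemma Lambda_mulmx (R : realType) (L : nat) (lambda : 'I_L -> 'I_L -> R)
    (p n q s r : nat) (E : (nat -> 'I_L) -> 'M[R]_(p, n)) (M : 'M[R]_(n, q))
    (l : nat -> 'I_L) :
  Lambda lambda s r (fun l => E l *m M) l = Lambda lambda s r E l *m M.
Proof.
elim: r s l => [|r IH] s l //=.
by rewrite mulmx_suml; apply: eq_bigr => c _; rewrite IH scalemxAl.
Qed.

Lemma Lambda_entry (R : realType) (L : nat) (lambda : 'I_L -> 'I_L -> R)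
    (p n s r : nat) (E : (nat -> 'I_L) -> 'M[R]_(p, n)) (i : 'I_p) (j : 'I_n)
    (l : nat -> 'I_L) :
  Lambda lambda s r (fun l => E l i j : R^o) l = Lambda lambda s r E l i j.
Proof.
elim: r s l => [|r IH] s l //=.
by rewrite summxE; apply: eq_bigr => c _; rewrite IH mxE.
Qed.

(** A tower argument: the induction hypothesis at [s.+1] averages out the later modes, then
    [markov_one_step] averages out the mode at [s.+1]. The first argument of [Y] carries the data
    known at time [s], the second the modes to be averaged. *)
Lemma integral_Lambda (disp : measure_display) (T : measurableType disp)
    (R : realType) (P : probability T R) (L : nat)
    (lambda : 'I_L -> 'I_L -> R) (theta : nat -> T -> 'I_L) (s r : nat)
    (Y : T -> (nat -> 'I_L) -> R^o) (E : set T) :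
  markov_chain P lambda theta ->
  causal theta s E -> causal theta s Y -> (forall w, local_on 0 (s + r) (Y w)) ->
  (\int[P]_(w in E) (Y w (theta^~ w))%:E =
   \int[P]_(w in E) (Lambda lambda s r (Y w) (theta^~ w))%:E)%E.
Proof.
move=> mc; elim: r s => [//|r IH] s cE cY lY.
rewrite (IH s.+1) //=; last first.
- by move=> w; rewrite addSnnS.
- exact: causalW cY.
- exact: causalW cE.
have lg w := @Lambda_local _ _ lambda _ 0 s.+1 r (Y w) isT.
(* The mode at time [s.+1] becomes a free variable [c]; what remains depends only on the path up to
   [s]. *)
pose Z w c := Lambda lambda s.+1 r (Y w) (set_mode (theta^~ w) s.+1 c).
have cZ : causal theta s Z.
  move=> w w' e; apply/funext => c; rewrite /Z (cY _ _ e).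
  apply: lg; first by rewrite addSnnS.
  move=> j; rewrite /set_mode; case: eqP => // /eqP j1 /andP[_ js].
  by apply: (causal_mode _ e); rewrite -ltnS ltn_neqAle j1.
apply: etrans (markov_one_step mc cE cZ).
apply: eq_integral => w _; congr EFin.
apply: lg; first by rewrite addSnnS.
(* Overwriting time [s.+1] with the actual mode leaves the trajectory unchanged. *)
by move=> j _; rewrite /set_mode; case: eqP => [->|].
Qed.

(** * Unrolling the delayed system, and causality of its state and controls *)

Lemma Fprod_nil (R : realType) (L n : nat) (A : 'I_L -> nat -> 'M[R]_n)
    (l : nat -> 'I_L) (t : nat) : Fprod A l t t.+1 = 1%:M.
Proof. by rewrite /Fprod /index_iota subnn big_nil. Qed.

Lemma Fprod_recl (R : realType) (L n : nat) (A : 'I_L -> nat -> 'M[R]_n)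
    (l : nat -> 'I_L) (t i : nat) : (i <= t.+1)%N ->
  Fprod A l t.+1 i = A (l t.+1) t.+1 *m Fprod A l t i.
Proof.
move=> it; rewrite /Fprod /index_iota (subSn it) -addn1 iotaD rev_cat /=.
by rewrite big_cons subnKC.
Qed.

Lemma Fprod_local (R : realType) (L n : nat) (A : 'I_L -> nat -> 'M[R]_n)
    (t i : nat) : local_on i t (fun l => Fprod A l t i).
Proof.
move=> l l' e; rewrite /Fprod; apply: eq_big_seq => j.
by rewrite mem_rev mem_index_iota ltnS => /e ->.
Qed.

(** Discrete variation of constants: each further step multiplies all products on the left by the
    new [A] and adds a term with empty product. The end time [(s + r).+1] avoids a truncated
    predecessor. *)
Lemma mjls_unroll (T : Type) (R : realType) (L n m d N : nat)
    (A : 'I_L -> nat -> 'M[R]_n) (B : 'I_L -> nat -> 'M[R]_(n, m))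
    (theta : nat -> T -> 'I_L) (x0 : 'cV[R]_n) (uinit : int -> 'cV[R]_m)
    (x : nat -> T -> 'cV[R]_n) (u : int -> T -> 'cV[R]_m) (s r : nat) (w : T) :
  delayed_mjls d N A B theta x0 uinit x u -> (s + r <= N)%N ->
  x (s + r).+1 w = Fprod A (theta^~ w) (s + r) s *m x s w
    + \sum_(s <= i < (s + r).+1)
        Fprod A (theta^~ w) (s + r) i.+1 *m B (theta i w) i
        *m u (i%:Z - d%:Z) w.
Proof.
case=> _ _ _ step; elim: r => [|r IH] rN.
  rewrite addn0 in rN *; rewrite step // big_nat1 Fprod_nil mul1mx.
  by rewrite /Fprod /index_iota subSnn /rev /= big_cons big_nil mulmx1.
rewrite addnS in rN *; rewrite step // (IH (ltnW rN)).
rewrite Fprod_recl; last by rewrite -addnS leq_addr.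
rewrite [in RHS]big_nat_recr /=; last by rewrite -addnS leq_addr.
rewrite Fprod_nil mul1mx mulmxDr mulmxA mulmx_sumr -addrA.
congr (_ + (_ + _)); apply: eq_big_nat => i /andP[_ ir].
by rewrite Fprod_recl // !mulmxA.
Qed.

(** The delay enters here: a control applied up to time [s + d] was chosen by time [s], or is
    deterministic initial data. *)
Lemma mjls_control_causal (T : Type) (R : realType) (L n m d N : nat)
    (A : 'I_L -> nat -> 'M[R]_n) (B : 'I_L -> nat -> 'M[R]_(n, m))
    (theta : nat -> T -> 'I_L) (x0 : 'cV[R]_n) (uinit : int -> 'cV[R]_m)
    (x : nat -> T -> 'cV[R]_n) (u : int -> T -> 'cV[R]_m) (s i : nat) :
  delayed_mjls d N A B theta x0 uinit x u -> (i <= s + d)%N ->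
  causal theta s (u (i%:Z - d%:Z)).
Proof.
case=> _ init adap _ isd; have [di|id] := leqP d i.
  rewrite subzn //; apply: (@causalW _ _ _ _ (i - d)); first by rewrite leq_subLR addnC.
  exact: mx_adapted_causal.
by move=> w w' _; rewrite !init // lerBrDl subrr lez_nat leq0n /= subr_lt0 ltz_nat.
Qed.

Lemma mjls_state_causal (T : Type) (R : realType) (L n m d N : nat)
    (A : 'I_L -> nat -> 'M[R]_n) (B : 'I_L -> nat -> 'M[R]_(n, m))
    (theta : nat -> T -> 'I_L) (x0 : 'cV[R]_n) (uinit : int -> 'cV[R]_m)
    (x : nat -> T -> 'cV[R]_n) (u : int -> T -> 'cV[R]_m) (k : nat) :
  delayed_mjls d N A B theta x0 uinit x u -> (k <= N.+1)%N ->
  causal theta k (x k).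
Proof.
move=> hx; have [x0E _ _ step] := hx.
elim: k => [|k IH] kN w w' e; first by rewrite !x0E.
rewrite !step // (causalW (leqnSn k) (IH (ltnW kN)) e).
rewrite (causal_mode (leqnSn k) e).
by rewrite (mjls_control_causal (s := k.+1) hx _ e) // addSn -addnS leq_addr.
Qed.

(** * The conditional expectation over [d] steps *)

Theorem lemma2 (R : realType) (disp : measure_display)
    (T : measurableType disp) (P : probability T R)
    (L n m p d N : nat) (hd : (0 < d)%N) (hN : (d < N)%N)
    (lambda : 'I_L -> 'I_L -> R) (theta : nat -> T -> 'I_L)
    (htheta : markov_chain P lambda theta)
    (A : 'I_L -> nat -> 'M[R]_n) (B : 'I_L -> nat -> 'M[R]_(n, m))
    (x0 : 'cV[R]_n) (uinit : int -> 'cV[R]_m)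
    (x : nat -> T -> 'cV[R]_n) (u : int -> T -> 'cV[R]_m)
    (hx : delayed_mjls d N A B theta x0 uinit x u)
    (k : nat) (hdk : (d <= k)%N) (hkN : (k <= N.+1)%N)
    (f : 'I_L -> 'M[R]_(p, n)) :
  is_mx_cond_expectation P (mode_sigma theta (k - d)%N)
    (fun w => f (theta k w) *m x k w)
    (fun w =>
       let l0 : nat -> 'I_L := fun=> theta (k - d)%N w in
       Lambda lambda (k - d)%N d
         (fun l => f (l k) *m Fprod A l k.-1 (k - d)%N) l0 *m x (k - d)%N w
       + \sum_(k - d <= i < k)
           Lambda lambda (k - d)%N d
             (fun l => f (l k) *m Fprod A l k.-1 i.+1 *m B (l i) i) l0
           *m u (i%:Z - d%:Z) w).
Proof.
have [mt _ _ _] := htheta.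
set s := (k - d)%N; have ks : k = (s + d)%N by rewrite subnK.
have sk1 : (s <= k.-1)%N by rewrite ks -subn1 -addnBA // leq_addr.
have k0 : (0 < k)%N := leq_trans hd hdk.
have cx : causal theta s (x s).
  by apply: (mjls_state_causal hx); exact: leq_trans (leq_subr _ _) hkN.
have cu i : (i < k)%N -> causal theta s (u (i%:Z - d%:Z)).
  by move=> ik; apply: (mjls_control_causal hx); rewrite -ks ltnW.
(* State and controls are frozen at the sample point [w], while the modes in the brackets vary
   freely with [l]. *)
pose W w l := f (l k) *m Fprod A l k.-1 s *m x s w
  + \sum_(s <= i < k)
      f (l k) *m Fprod A l k.-1 i.+1 *m B (l i) i *m u (i%:Z - d%:Z) w.
have cW : causal theta s W.
  move=> w w' e; apply/funext => l; rewrite /W (cx _ _ e); congr (_ + _).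
  by apply: eq_big_nat => i /andP[_ ik]; rewrite (cu i ik _ _ e).
have lF i t : (s <= i)%N -> (t <= k)%N ->
    local_on s k (fun l => Fprod A l t i).
  move=> si tk l l' e; apply: Fprod_local => j /andP[ij jt].
  by apply: e; rewrite (leq_trans si ij) (leq_trans jt tk).
have lf l l' : agree s k l l' -> f (l k) = f (l' k).
  by move=> -> //; rewrite leqnn leq_subr.
have lM : local_on s k (fun l => f (l k) *m Fprod A l k.-1 s).
  by move=> l l' e; rewrite (lf _ _ e) (lF s _ _ _ _ _ e) // leq_pred.
have lN i : (s <= i < k)%N ->
    local_on s k (fun l => f (l k) *m Fprod A l k.-1 i.+1 *m B (l i) i).
  move=> /andP[si ik] l l' e.
  rewrite (lf _ _ e) (lF i.+1 k.-1 _ _ _ _ e) ?leq_pred ?leqW //.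
  by rewrite (e i) // si ltnW.
have lW w : local_on s k (W w).
  move=> l l' e; rewrite /W (lM _ _ e); congr (_ + _).
  by apply: eq_big_nat => i hi; rewrite (lN i hi _ _ e).
have XE w : f (theta k w) *m x k w = W w (theta^~ w).
  rewrite -[in x k](prednK k0) -(subnKC sk1) (mjls_unroll _ hx); last first.
    by rewrite subnKC // -ltnS prednK.
  rewrite subnKC // prednK // mulmxDr mulmxA mulmx_sumr; congr (_ + _).
  by apply: eq_big_nat => i _; rewrite !mulmxA.
pose Z w : 'cV[R]_p := Lambda lambda s d (W w) (theta^~ w).
set V := (X in is_mx_cond_expectation _ _ _ X).
(* Linearity splits [Z] into the claimed terms; the constant sequence may replace the trajectory
   because [Lambda] reads only the mode at [s]. *)
have -> : V = Z.
  apply/funext => w; rewrite /V /Z /W Lambda_add Lambda_sum Lambda_mulmx.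
  have agr : agree s s (fun=> theta s w) (theta^~ w).
    by move=> j; rewrite -eqn_leq => /eqP ->.
  congr (_ *m _ + _); first by apply: Lambda_local agr; rewrite -?ks.
  apply: eq_big_nat => i hi; rewrite Lambda_mulmx; congr (_ *m _).
  by apply: Lambda_local agr; rewrite -?ks //; exact: lN.
have cZ : causal theta s Z.
  move=> w w' e; rewrite /Z (cW _ _ e).
  apply: (@Lambda_local _ _ _ _ s s d); rewrite -?ks //.
  by move=> j; rewrite -eqn_leq => /eqP <-; apply: (causal_mode _ e).
move=> i j; split.
- apply: (@causal_integrable _ _ _ P _ theta k _ mt) => w w' e.
  by rewrite (mjls_state_causal hx hkN e) (causal_mode (leqnn k) e).
- by apply: (@causal_integrable _ _ _ P _ theta s _ mt) => w w' /cZ ->.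
- by apply: causal_adapted => w w' /cZ ->.
move=> E /mode_sigma_causal cE.
(* The integral identity holds entry by entry: [integral_Lambda] applies to scalars, viewed as the
   module [R^o]. *)
under [RHS]eq_integral do rewrite XE.
have ZE w : Z w i j =
    Lambda lambda s d (fun l => W w l i j : R^o) (theta^~ w).
  by rewrite Lambda_entry.
under [LHS]eq_integral do rewrite ZE.
apply/esym/(integral_Lambda (Y := fun w l => W w l i j) htheta cE).
  by move=> w w' e; rewrite (cW _ _ e).
move=> w l l' e; rewrite (lW w l l') // => a /andP[_ ak].
by apply: e; rewrite -ks.
Qed.
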